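(* Let $L=\langle\omega,\wedge,\vee,\leq_L\rangle$ be a c.e. pre-lattice and let $a<_L b$ be such that the pair of equivalence classes $([a]_L,[b]_L)$ is effectively inseparable. Then every c.e. pre-order can be reduced to the interval $[a,b]_L$: for every c.e. pre-ordering relation $R$ on $\omega$ there is a computable function $f:\omega\to\omega$ whose range is contained in $[a,b]_L$ and such that for all $x,y$, $x\mathrel{R}y$ if and only if $f(x)\leq_L f(y)$.
   Context: $W_u$ denotes the $u$-th c.e. set. A pre-ordering relation is a reflexive transitive relation on $\omega$; it is c.e. if it is c.e. as a set of pairs. All pre-orders are assumed non-trivial (the quotient by the induced equivalence relation has more than one element). A c.e. pre-lattice is a structure $L=\langle\omega,\wedge,\vee,\leq_L\rangle$ with $\wedge,\vee$ computable binary operations and $\leq_L$ a c.e. pre-ordering relation, such that the equivalence relation $\equiv_L$ ($x\equiv_L y$ iff $x\leq_L y$ and $y\leq_L x$) is a congruence and the quotient $L/{\equiv_L}$, ordered by the partial order induced by $\leq_L$, is a lattice in which $\wedge$ and $\vee$ induce meet and join. Neither distributivity nor boundedness is assumed. $[a]_L$ is the $\equiv_L$-class of $a$; $a<_L b$ means $a\leq_L b$ and $b\not\leq_L a$; $[a,b]_L=\{x: a\leq_L x\leq_L b\}$. A disjoint pair $(A,B)$ of sets is effectively inseparable (e.i.) if there is a partial computable function $\phi(u,v)$ such that whenever $A\subseteq W_u$, $B\subseteq W_v$ and $W_u\cap W_v=\emptyset$, then $\phi(u,v)$ is defined and $\phi(u,v)\notin W_u\cup W_v$. *)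

(* Defs.v *)
From Stdlib Require Import Arith Cantor RelationClasses Morphisms.

Notation "⟪ x , y ⟫" := (Cantor.to_nat (x, y)).

(* Programs for unary partial recursive functions; functions of several
   arguments are handled through Cantor's bijection nat * nat -> nat.  The
   identity is [Pair Fst Snd], since the pairing is surjective. *)
Inductive code : Set :=
| Zero
| Succ
| Fst
| Snd
| Pair (f g : code)
| Comp (f g : code)
| Prec (f g : code)
| Mu (f : code).

(* [eval c x y]: the function computed by [c] is defined at [x] with value [y].
   [Prec f g] computes h with  h⟪x,0⟫ = f(x),  h⟪x,n+1⟫ = g⟪x,⟪n,h⟪x,n⟫⟫⟫.
   [Mu f] maps x to the least n with f⟪x,n⟫ = 0, provided that f⟪x,m⟫ is
   defined for all m < n. *)
Fixpoint eval (c : code) (x y : nat) : Prop :=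
  match c with
  | Zero => y = 0
  | Succ => y = S x
  | Fst => y = fst (Cantor.of_nat x)
  | Snd => y = snd (Cantor.of_nat x)
  | Pair f g => exists u v, eval f x u /\ eval g x v /\ y = ⟪u, v⟫
  | Comp f g => exists u, eval g x u /\ eval f u y
  | Prec f g =>
      let p := fst (Cantor.of_nat x) in
      (fix rec (n r : nat) : Prop :=
         match n with
         | 0 => eval f p r
         | S m => exists s, rec m s /\ eval g ⟪p, ⟪m, s⟫⟫ r
         end) (snd (Cantor.of_nat x)) y
  | Mu f =>
      eval f ⟪x, y⟫ 0 /\ forall m, m < y -> exists k, eval f ⟪x, m⟫ (S k)
  end.

Lemma eval_functional (c : code) :
  forall x y z, eval c x y -> eval c x z -> y = z.
Proof.
  induction c as [| | | |f IHf g IHg|f IHf g IHg|f IHf g IHg|f IHf];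
    intros x y z; simpl; try congruence.
  - intros (u & v & Hu & Hv & ->) (u' & v' & Hu' & Hv' & ->).
    now rewrite (IHf _ _ _ Hu Hu'), (IHg _ _ _ Hv Hv').
  - intros (u & Hu & Hy) (u' & Hu' & Hz).
    rewrite (IHg _ _ _ Hu' Hu) in Hz. eauto.
  - generalize (fst (Cantor.of_nat x)) as p.
    intro p. revert y z.
    induction (snd (Cantor.of_nat x)) as [|n IHn]; intros y z; [eauto|].
    intros (s & Hs & Hy) (s' & Hs' & Hz).
    rewrite (IHn _ _ Hs' Hs) in Hz. eauto.
  - intros [Hy Hly] [Hz Hlz].
    destruct (lt_eq_lt_dec y z) as [[H|H]|H]; [|exact H|].
    + destruct (Hlz _ H) as [k Hk]. discriminate (IHf _ _ _ Hy Hk).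
    + destruct (Hly _ H) as [k Hk]. discriminate (IHf _ _ _ Hz Hk).
Qed.

Fixpoint encode (c : code) : nat :=
  match c with
  | Zero => ⟪0, 0⟫
  | Succ => ⟪1, 0⟫
  | Fst => ⟪2, 0⟫
  | Snd => ⟪3, 0⟫
  | Pair f g => ⟪4, ⟪encode f, encode g⟫⟫
  | Comp f g => ⟪5, ⟪encode f, encode g⟫⟫
  | Prec f g => ⟪6, ⟪encode f, encode g⟫⟫
  | Mu f => ⟪7, encode f⟫
  end.

Lemma encode_injective (c d : code) : encode c = encode d -> c = d.
Proof.
  assert (inj : forall x y x' y', ⟪x, y⟫ = ⟪x', y'⟫ -> x = x' /\ y = y').
  { intros x y x' y' H. apply Cantor.to_nat_inj in H. now inversion H. }
  revert d; induction c; intros []; cbn [encode]; intro H;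
    apply inj in H; destruct H as [H1 H2]; try discriminate H1;
    try reflexivity; try (apply inj in H2; destruct H2); f_equal; auto.
Qed.

(* The [u]-th c.e. set: the domain of the program with Gödel number [u], and
   the empty set if [u] is not a Gödel number. *)
Definition W (u x : nat) : Prop :=
  exists c, encode c = u /\ exists y, eval c x y.

Definition computable (f : nat -> nat) : Prop :=
  exists c, forall x, eval c x (f x).

Definition computable2 (f : nat -> nat -> nat) : Prop :=
  exists c, forall x y, eval c ⟪x, y⟫ (f x y).

(* [phi] is given by its graph, which is single-valued by [eval_functional]. *)
Definition partial_computable2 (phi : nat -> nat -> nat -> Prop) : Prop :=
  exists c, forall u v y, phi u v y <-> eval c ⟪u, v⟫ y.

Definition ce_rel (R : nat -> nat -> Prop) : Prop :=
  exists u, forall x y, R x y <-> W u ⟪x, y⟫.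

Definition effectively_inseparable (A B : nat -> Prop) : Prop :=
  (forall x, ~ (A x /\ B x)) /\
  exists phi, partial_computable2 phi /\
    forall u v,
      (forall x, A x -> W u x) ->
      (forall x, B x -> W v x) ->
      (forall x, ~ (W u x /\ W v x)) ->
      exists y, phi u v y /\ ~ (W u y \/ W v y).

Definition equ (R : nat -> nat -> Prop) (x y : nat) : Prop := R x y /\ R y x.

Record ce_preorder (R : nat -> nat -> Prop) : Prop := {
  cep_preorder : PreOrder R;
  cep_ce : ce_rel R;
  cep_nontrivial : exists x y, ~ equ R x y
}.

(* The last six fields say, on representatives, that in the quotient by
   [equ leq] the classes of [meet x y] and [join x y] are the infimum and the
   supremum of the classes of [x] and [y]. *)
Record ce_prelattice (meet join : nat -> nat -> nat)
    (leq : nat -> nat -> Prop) : Prop := {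
  cel_preorder : ce_preorder leq;
  cel_meet_computable : computable2 meet;
  cel_join_computable : computable2 join;
  cel_meet_congr : Proper (equ leq ==> equ leq ==> equ leq) meet;
  cel_join_congr : Proper (equ leq ==> equ leq ==> equ leq) join;
  cel_meet_l : forall x y, leq (meet x y) x;
  cel_meet_r : forall x y, leq (meet x y) y;
  cel_meet_glb : forall x y z, leq z x -> leq z y -> leq z (meet x y);
  cel_join_l : forall x y, leq x (join x y);
  cel_join_r : forall x y, leq y (join x y);
  cel_join_lub : forall x y z, leq x z -> leq y z -> leq (join x y) z
}.

Definition lt_of (leq : nat -> nat -> Prop) (a b : nat) : Prop :=
  leq a b /\ ~ leq b a.

Definition eq_class (leq : nat -> nat -> Prop) (a x : nat) : Prop :=
  equ leq x a.

Definition interval (leq : nat -> nat -> Prop) (a b x : nat) : Prop :=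
  leq a x /\ leq x b.

(* Main.v *)
Require Import Defs.
From Stdlib Require Import Arith Lia Bool Cantor RelationClasses.
From Stdlib Require Import Classical ConstructiveEpsilon.

(** Effective inseparability of [([a], [b])] yields, by self-reference, a
    computable sequence of controls: elements [g k] of [[a,b]] each of which
    can be forced at any later stage, by a decision procedure that may itself
    refer to [g], to be equivalent to [a] or to [b] ([delayed_controls]).
    Indeed let [g k] be the value of the productive function on c.e. supersets
    of [[a]] and [[b]], and force [g k] into one class by enumerating it into
    the superset of the other: the value then lies in one of the two supersets,
    so these must intersect, and they can do so only at [g k].

    The reduction [f] is a sequence of lattice terms in the controls.  The
    element [f n] must be placed among the [f m], [m < n], but the relations
    between [n] and the [m < n] are enumerated only later.  It is therefore a
    nested term: [Z 0 = a],

      [Z (r+1) = low r \/ (up r /\ Z r)]  and  [f n = Z (2n+2)],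

    where [low r] is the join of one control and of the [f m /\ c_m], and
    [up r] is the meet of the [f m \/ d_m], for controls [c_m], [d_m] that
    belong to slot [r] alone.  Whenever a new relation between [n] and some
    [m < n] shows up, the next slot inwards is decided so that [low r] becomes
    the join of the [f m] known to be below [f n], and [up r] the meet of those
    known to be above.  There are at most [2n] such events, hence enough slots.
    As [low] lies below [up] and later slots refine earlier ones, the innermost
    decided slot confines [f n] to the required interval, whatever the value
    of the remaining slots and without any use of distributivity
    ([f_monotone]).

    To see that [f i <= f j] implies [R i j], the construction watches for an
    inequality [f i <= f j] together with a set [X] that contains [i], omits
    [j], and is closed upwards, among the numbers up to [i + j], under the part
    of [R] enumerated so far.  At the first such stage all undecided slots of
    each [f n] are set to [b] if [n] is in [X] and to [a] otherwise.  Then, for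
    [n <= i + j], [f n] is equivalent to [b] or to [a] accordingly
    ([separation_decides]), so that [b <= f i <= f j <= a], which is impossible.  Hence this never happens; but if [R i j] failed, then
    the upper cone of [i] in [R] would be such a set [X]. *)

(** * Closure properties of the computable functions *)

(** The projections of Cantor's pairing. *)
Definition p1 (x : nat) : nat := fst (Cantor.of_nat x).
Definition p2 (x : nat) : nat := snd (Cantor.of_nat x).

Lemma p1_pair x y : p1 ⟪x, y⟫ = x.
Proof. unfold p1. now rewrite Cantor.cancel_of_to. Qed.

Lemma p2_pair x y : p2 ⟪x, y⟫ = y.
Proof. unfold p2. now rewrite Cantor.cancel_of_to. Qed.

(** Rewriting with [p1_pair] and [p2_pair], twice because projections are
    nested. *)
Tactic Notation "unpair" := rewrite ?p1_pair, ?p2_pair, ?p1_pair, ?p2_pair.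
Tactic Notation "unpair" "in" hyp(H) :=
  rewrite ?p1_pair, ?p2_pair, ?p1_pair, ?p2_pair in H.

Lemma pair_p x : ⟪p1 x, p2 x⟫ = x.
Proof.
  unfold p1, p2. rewrite <- surjective_pairing. apply Cantor.cancel_to_of.
Qed.

Global Opaque Cantor.to_nat Cantor.of_nat.

(** Primitive recursion, with the recursion argument last. *)
Fixpoint natrec (b : nat) (s : nat -> nat -> nat) (n : nat) : nat :=
  match n with
  | 0 => b
  | S m => s m (natrec b s m)
  end.

(** Computability of ternary functions, by currying through the pairing. *)
Definition computable3 (f : nat -> nat -> nat -> nat) : Prop :=
  computable (fun p => f (p1 p) (p1 (p2 p)) (p2 (p2 p))).

Lemma computable_ext f g :
  (forall x, f x = g x) -> computable f -> computable g.
Proof. intros E [c H]. exists c. intros x. rewrite <- E. apply H. Qed.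

Lemma computable2_iff f :
  computable2 f <-> computable (fun p => f (p1 p) (p2 p)).
Proof.
  split; intros [c H]; exists c.
  - intros x. rewrite <- (pair_p x) at 1. apply H.
  - intros x y. generalize (H ⟪x, y⟫). now rewrite p1_pair, p2_pair.
Qed.

Lemma computable_id : computable (fun x => x).
Proof.
  exists (Pair Fst Snd). intros x. exists (p1 x), (p2 x).
  repeat split. symmetry. apply pair_p.
Qed.

Lemma computable_comp f g :
  computable f -> computable g -> computable (fun x => f (g x)).
Proof. intros [c Hc] [d Hd]. exists (Comp c d). intros x. exists (g x). auto. Qed.

Lemma computable_pair f g :
  computable f -> computable g -> computable (fun x => ⟪f x, g x⟫).
Proof.
  intros [c Hc] [d Hd]. exists (Pair c d). intros x. exists (f x), (g x). auto.
Qed.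

Lemma computable_succ f : computable f -> computable (fun x => S (f x)).
Proof. apply computable_comp. now exists Succ. Qed.

Lemma computable_p1 f : computable f -> computable (fun x => p1 (f x)).
Proof. apply computable_comp. now exists Fst. Qed.

Lemma computable_p2 f : computable f -> computable (fun x => p2 (f x)).
Proof. apply computable_comp. now exists Snd. Qed.

Lemma computable_const k : computable (fun _ => k).
Proof.
  induction k as [|k IH].
  - now exists Zero.
  - now apply computable_succ.
Qed.

Lemma computable_app2 F f g :
  computable2 F -> computable f -> computable g ->
  computable (fun x => F (f x) (g x)).
Proof.
  intros HF Hf Hg. apply computable2_iff in HF.
  generalize (computable_comp _ _ HF (computable_pair _ _ Hf Hg)).
  apply computable_ext. intros x. now rewrite p1_pair, p2_pair.
Qed.

Lemma computable_app3 F f g h :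
  computable3 F -> computable f -> computable g -> computable h ->
  computable (fun x => F (f x) (g x) (h x)).
Proof.
  intros HF Hf Hg Hh.
  generalize (computable_comp _ _ HF
    (computable_pair _ _ Hf (computable_pair _ _ Hg Hh))).
  apply computable_ext. intros x. now rewrite !p2_pair, !p1_pair.
Qed.

Lemma computable_natrec b s n :
  computable b -> computable3 s -> computable n ->
  computable (fun x => natrec (b x) (s x) (n x)).
Proof.
  intros [cb Hb] [cs Hs] [cn Hn].
  exists (Comp (Prec cb cs) (Pair (Pair Fst Snd) cn)).
  intros x. exists ⟪x, n x⟫. split.
  - exists x, (n x). repeat split; [|apply Hn].
    exists (p1 x), (p2 x). repeat split. symmetry. apply pair_p.
  - simpl. fold (p1 ⟪x, n x⟫) (p2 ⟪x, n x⟫). rewrite p1_pair, p2_pair.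
    induction (n x) as [|m IH]; [apply Hb|].
    exists (natrec (b x) (s x) m). split; [exact IH|].
    generalize (Hs ⟪x, ⟪m, natrec (b x) (s x) m⟫⟫).
    now rewrite !p2_pair, !p1_pair.
Qed.

Lemma computable_case f b s :
  computable f -> computable b -> computable2 s ->
  computable (fun x => match f x with 0 => b x | S n => s x n end).
Proof.
  intros Hf Hb Hs.
  apply computable_ext with (fun x => natrec (b x) (fun n _ => s x n) (f x)).
  { intros x. now destruct (f x). }
  apply (computable_natrec b (fun x n _ => s x n) f); auto.
  apply (computable_app2 s); auto;
    repeat first [apply computable_p1 | apply computable_p2 | apply computable_id].
Qed.

Lemma computable_if (P : nat -> bool) f g :
  computable (fun x => Nat.b2n (P x)) -> computable f -> computable g ->
  computable (fun x => if P x then f x else g x).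
Proof.
  intros HP Hf Hg.
  apply computable_ext with
    (fun x => match Nat.b2n (P x) with 0 => g x | S _ => f x end).
  { intros x. now destruct (P x). }
  apply (computable_case (fun x => Nat.b2n (P x)) g (fun x _ => f x)); auto.
  apply computable2_iff. apply (computable_comp f); auto.
  apply computable_p1, computable_id.
Qed.

Lemma computable_add f g :
  computable f -> computable g -> computable (fun x => f x + g x).
Proof.
  intros Hf Hg.
  apply computable_ext with (fun x => natrec (f x) (fun _ r => S r) (g x)).
  { intros x. induction (g x); simpl; lia. }
  apply (computable_natrec f (fun _ _ r => S r) g); auto.
  apply computable_succ, computable_p2, computable_p2, computable_id.
Qed.

Lemma computable_pred f : computable f -> computable (fun x => Nat.pred (f x)).
Proof.
  intros Hf. apply computable_ext with
    (fun x => match f x with 0 => 0 | S n => n end).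
  { intros x. now destruct (f x). }
  apply (computable_case f (fun _ => 0) (fun _ n => n)); auto.
  - apply computable_const.
  - apply computable2_iff, computable_p2, computable_id.
Qed.

Lemma computable_sub f g :
  computable f -> computable g -> computable (fun x => f x - g x).
Proof.
  intros Hf Hg.
  apply computable_ext with (fun x => natrec (f x) (fun _ r => Nat.pred r) (g x)).
  { intros x. induction (g x); simpl; lia. }
  apply (computable_natrec f (fun _ _ r => Nat.pred r) g); auto.
  apply computable_pred, computable_p2, computable_p2, computable_id.
Qed.

Lemma computable_negb (P : nat -> bool) :
  computable (fun x => Nat.b2n (P x)) ->
  computable (fun x => Nat.b2n (negb (P x))).
Proof.
  intros HP. apply computable_ext with (fun x => 1 - Nat.b2n (P x)).
  { intros x. now destruct (P x). }
  apply computable_sub; auto. apply computable_const.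
Qed.

Lemma computable_andb (P Q : nat -> bool) :
  computable (fun x => Nat.b2n (P x)) -> computable (fun x => Nat.b2n (Q x)) ->
  computable (fun x => Nat.b2n (P x && Q x)).
Proof.
  intros HP HQ.
  apply computable_ext with (fun x => if P x then Nat.b2n (Q x) else 0).
  { intros x. now destruct (P x). }
  apply computable_if; auto. apply computable_const.
Qed.

Lemma computable_orb (P Q : nat -> bool) :
  computable (fun x => Nat.b2n (P x)) -> computable (fun x => Nat.b2n (Q x)) ->
  computable (fun x => Nat.b2n (P x || Q x)).
Proof.
  intros HP HQ.
  apply computable_ext with (fun x => if P x then 1 else Nat.b2n (Q x)).
  { intros x. now destruct (P x). }
  apply computable_if; auto. apply computable_const.
Qed.

Lemma computable_ifb (P Q T : nat -> bool) :
  computable (fun x => Nat.b2n (P x)) -> computable (fun x => Nat.b2n (Q x)) ->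
  computable (fun x => Nat.b2n (T x)) ->
  computable (fun x => Nat.b2n (if P x then Q x else T x)).
Proof.
  intros HP HQ HT.
  apply computable_ext with
    (fun x => if P x then Nat.b2n (Q x) else Nat.b2n (T x)).
  { intros x. now destruct (P x). }
  now apply computable_if.
Qed.

Lemma computable_leb f g :
  computable f -> computable g -> computable (fun x => Nat.b2n (f x <=? g x)).
Proof.
  intros Hf Hg. apply computable_ext with (fun x => 1 - (f x - g x)).
  { intros x. destruct (Nat.leb_spec (f x) (g x)); cbn [Nat.b2n]; lia. }
  repeat apply computable_sub; auto. apply computable_const.
Qed.

Lemma computable_eqb f g :
  computable f -> computable g -> computable (fun x => Nat.b2n (f x =? g x)).
Proof.
  intros Hf Hg.
  apply computable_ext with (fun x => 1 - ((f x - g x) + (g x - f x))).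
  { intros x. destruct (Nat.eqb_spec (f x) (g x)); cbn [Nat.b2n]; lia. }
  apply computable_sub; [apply computable_const|].
  apply computable_add; apply computable_sub; auto.
Qed.

(** Bounded quantifiers over [m < n]. *)
Fixpoint ball (P : nat -> bool) (n : nat) : bool :=
  match n with 0 => true | S m => ball P m && P m end.

Definition bex (P : nat -> bool) (n : nat) : bool :=
  negb (ball (fun m => negb (P m)) n).

Lemma ball_true P n : ball P n = true <-> forall m, m < n -> P m = true.
Proof.
  induction n as [|n IH]; simpl.
  - split; [intros _ m Hm; lia|reflexivity].
  - rewrite andb_true_iff, IH. split.
    + intros [H1 H2] m Hm.
      destruct (Nat.eq_dec m n) as [->|]; [exact H2|apply H1; lia].
    + intros H. split; [intros; apply H; lia|apply H; lia].
Qed.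

Lemma bex_true P n : bex P n = true <-> exists m, m < n /\ P m = true.
Proof.
  unfold bex. induction n as [|n IH]; simpl.
  - split; [discriminate|intros (m & Hm & _); lia].
  - rewrite negb_andb, negb_involutive, orb_true_iff, IH. split.
    + intros [(m & Hm & H)|H]; [exists m|exists n]; auto with arith.
    + intros (m & Hm & H).
      destruct (Nat.eq_dec m n) as [->|]; [now right|].
      left. exists m. split; [lia|exact H].
Qed.

Lemma computable_ball (P : nat -> nat -> bool) n :
  computable2 (fun x m => Nat.b2n (P x m)) -> computable n ->
  computable (fun x => Nat.b2n (ball (P x) (n x))).
Proof.
  intros HP Hn.
  apply computable_ext with
    (fun x => natrec 1 (fun m r => if P x m then r else 0) (n x)).
  { intros x. induction (n x) as [|m IH]; simpl; [reflexivity|].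
    rewrite IH. destruct (P x m), (ball (P x) m); reflexivity. }
  apply (computable_natrec (fun _ => 1)
           (fun x m r => if P x m then r else 0) n); auto.
  { apply computable_const. }
  apply computable_if.
  - apply (computable_app2 (fun x m => Nat.b2n (P x m))); auto;
      repeat first [apply computable_p1 | apply computable_p2
                   | apply computable_id].
  - apply computable_p2, computable_p2, computable_id.
  - apply computable_const.
Qed.

Lemma computable_bex (P : nat -> nat -> bool) n :
  computable2 (fun x m => Nat.b2n (P x m)) -> computable n ->
  computable (fun x => Nat.b2n (bex (P x) (n x))).
Proof.
  intros HP Hn. apply computable_negb.
  apply (computable_ball (fun x m => negb (P x m))); auto.
  apply computable2_iff, computable_negb. now apply computable2_iff in HP.
Qed.

(** [computability] proves [computable (fun x => t)] by recursion on the
    syntax of [t]; the computability of the other functions in [t] is taken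
    from the hypotheses. *)
Ltac computability_step :=
  cbv beta;
  lazymatch goal with
  | |- computable2 _ => apply computable2_iff
  | |- computable3 _ => unfold computable3
  | |- computable p1 => now exists Fst
  | |- computable p2 => now exists Snd
  | |- computable (fun _ => ?k) => apply (computable_const k)
  | |- computable (fun x => x) => apply computable_id
  | |- computable (fun x => p1 (@?f x)) => apply (computable_p1 f)
  | |- computable (fun x => p2 (@?f x)) => apply (computable_p2 f)
  | |- computable (fun x => S (@?f x)) => apply (computable_succ f)
  | |- computable (fun x => Nat.pred (@?f x)) => apply (computable_pred f)
  | |- computable (fun x => Cantor.to_nat (@?f x, @?g x)) =>
      apply (computable_pair f g)
  | |- computable (fun x => @?f x + @?g x) => apply (computable_add f g)
  | |- computable (fun x => @?f x - @?g x) => apply (computable_sub f g)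
  | |- computable (fun x => natrec (@?b x) (@?s x) (@?n x)) =>
      apply (computable_natrec b s n)
  | |- computable (fun x => match @?f x with 0 => @?b x | S n => _ end) =>
      apply (computable_case f b)
  | |- computable (fun x => if @?P x then @?f x else @?g x) =>
      apply (computable_if P f g)
  | |- computable (fun x => Nat.b2n (@?P x && @?Q x)) =>
      apply (computable_andb P Q)
  | |- computable (fun x => Nat.b2n (@?P x || @?Q x)) =>
      apply (computable_orb P Q)
  | |- computable (fun x => Nat.b2n (if @?P x then @?Q x else @?T x)) =>
      apply (computable_ifb P Q T)
  | |- computable (fun x => Nat.b2n (negb (@?P x))) => apply (computable_negb P)
  | |- computable (fun x => Nat.b2n (@?f x <=? @?g x)) =>
      apply (computable_leb f g)
  | |- computable (fun x => Nat.b2n (@?f x <? @?g x)) =>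
      apply (computable_leb (fun x => S (f x)) g)
  | |- computable (fun x => Nat.b2n (@?f x =? @?g x)) =>
      apply (computable_eqb f g)
  | |- computable (fun x => Nat.b2n (ball (@?P x) (@?n x))) =>
      apply (computable_ball P n)
  | |- computable (fun x => Nat.b2n (bex (@?P x) (@?n x))) =>
      apply (computable_bex P n)
  | _ => match goal with
  | |- computable (fun x => Nat.b2n (?F (@?f x) (@?g x) (@?h x))) =>
      apply (computable_app3 (fun u v w => Nat.b2n (F u v w)) f g h);
      [assumption|..]
  | |- computable (fun x => Nat.b2n (?F (@?f x) (@?g x))) =>
      apply (computable_app2 (fun u v => Nat.b2n (F u v)) f g);
      [assumption|..]
  | |- computable (fun x => ?F (@?f x) (@?g x) (@?h x)) =>
      apply (computable_app3 F f g h); [assumption|..]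
  | |- computable (fun x => ?F (@?f x) (@?g x)) =>
      apply (computable_app2 F f g); [assumption|..]
  | |- computable (fun x => ?F (@?f x)) =>
      apply (computable_comp F f); [assumption|..]
  end
  end.
Ltac computability := repeat computability_step.

(** * Step-bounded evaluation *)

(** [st t x] is the result of running [c] on [x] with budget [t], coded as [0]
    for no answer yet and as [S y] for the answer [y]. *)
Definition stepped (c : code) (st : nat -> nat -> nat) : Prop :=
  computable2 st /\
  (forall t x y, st t x = S y -> eval c x y) /\
  (forall x y, eval c x y -> exists t0, forall t, t0 <= t -> st t x = S y).

Lemma stepped_total c f :
  (forall x y, eval c x y <-> y = f x) -> exists st, stepped c st.
Proof.
  intros H. exists (fun _ x => S (f x)). split; [|split].
  - apply computable2_iff, computable_succ, (computable_comp f).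
    + exists c. intros x. now apply H.
    + computability.
  - intros t x y [= <-]. now apply H.
  - intros x y E. exists 0. intros. f_equal. symmetry. now apply H.
Qed.

(** Search for the first [m < n] with [s m = 1] before which [s] takes values
    above [1] only: [S (S m)] if it is found, [1] if some value [0] blocks
    it, and [0] if all values are above [1]. *)
Definition mu_scan (s : nat -> nat) (n : nat) : nat :=
  natrec 0 (fun m r =>
    match r with
    | 0 => match s m with
           | 0 => 1
           | S v => match v with 0 => S (S m) | S _ => 0 end
           end
    | S r' => S r'
    end) n.

Lemma mu_scan_succ s n :
  mu_scan s (S n) =
  match mu_scan s n with
  | 0 => match s n with
         | 0 => 1
         | S v => match v with 0 => S (S n) | S _ => 0 end
         end
  | S r => S r
  end.
Proof. reflexivity. Qed.

Lemma mu_scan_spec s n :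
  match mu_scan s n with
  | 0 => forall m, m < n -> exists k, s m = S (S k)
  | 1 => exists m, m < n /\ s m = 0
  | S (S y) => s y = 1 /\ forall m, m < y -> exists k, s m = S (S k)
  end.
Proof.
  induction n as [|n IH]; [simpl; lia|].
  rewrite mu_scan_succ. destruct (mu_scan s n) as [|[|y]].
  - destruct (s n) as [|[|v]] eqn:E; cbv beta iota;
      [exists n; split; auto|split; auto|].
    intros m Hm. destruct (Nat.eq_dec m n) as [->|]; [eauto|apply IH; lia].
  - destruct IH as (m & Hm & E). exists m. auto with arith.
  - exact IH.
Qed.


Lemma mu_scan_found s y n :
  s y = 1 -> (forall m, m < y -> exists k, s m = S (S k)) -> y < n ->
  mu_scan s n = S (S y).
Proof.
  intros Hy Hm Hn. replace n with (S y + (n - S y)) by lia.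
  generalize (n - S y). clear n Hn. intros n. induction n as [|n IH].
  - assert (E : forall n, n <= y -> mu_scan s n = 0).
    { intros n. induction n as [|n IH]; intros Hn; [reflexivity|].
      rewrite mu_scan_succ, IH by lia.
      destruct (Hm n Hn) as [k ->]. reflexivity. }
    now rewrite Nat.add_0_r, mu_scan_succ, E, Hy.
  - now rewrite Nat.add_succ_r, mu_scan_succ, IH.
Qed.

Lemma exists_stepped c : exists st, stepped c st.
Proof.
  induction c as [| | | |f IHf g IHg|f IHf g IHg|f IHf g IHg|f IHf].
  - apply stepped_total with (fun _ => 0). reflexivity.
  - apply stepped_total with S. reflexivity.
  - apply stepped_total with p1. reflexivity.
  - apply stepped_total with p2. reflexivity.
  - destruct IHf as (sf & Cf & Sf & Ef), IHg as (sg & Cg & Sg & Eg).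
    exists (fun t x => match sf t x with
                       | 0 => 0
                       | S u => match sg t x with 0 => 0 | S v => S ⟪u, v⟫ end
                       end).
    split; [|split].
    + computability.
    + intros t x y. destruct (sf t x) as [|u] eqn:E1; [discriminate|].
      destruct (sg t x) as [|v] eqn:E2; [discriminate|].
      intros [= <-]. exists u, v. eauto.
    + intros x y (u & v & Hu & Hv & ->).
      destruct (Ef _ _ Hu) as [t1 H1], (Eg _ _ Hv) as [t2 H2].
      exists (t1 + t2). intros t Ht. rewrite H1, H2 by lia. reflexivity.
  - destruct IHf as (sf & Cf & Sf & Ef), IHg as (sg & Cg & Sg & Eg).
    exists (fun t x => match sg t x with 0 => 0 | S u => sf t u end).
    split; [|split].
    + computability.
    + intros t x y. destruct (sg t x) as [|u] eqn:E1; [discriminate|].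
      intros E2. exists u. eauto.
    + intros x y (u & Hu & Hy).
      destruct (Eg _ _ Hu) as [t1 H1], (Ef _ _ Hy) as [t2 H2].
      exists (t1 + t2). intros t Ht. rewrite H1, H2 by lia. reflexivity.
  - destruct IHf as (sf & Cf & Sf & Ef), IHg as (sg & Cg & Sg & Eg).
    exists (fun t x => natrec (sf t (p1 x))
              (fun m r => match r with
                          | 0 => 0
                          | S s => sg t ⟪p1 x, ⟪m, s⟫⟫
                          end) (p2 x)).
    split; [|split].
    + computability.
    + intros t x y. simpl. fold (p1 x) (p2 x).
      revert y. induction (p2 x) as [|m IH]; intros y; simpl; [apply Sf|].
      destruct (natrec _ _ m) as [|s]; [discriminate|].
      intros E. exists s. split; [now apply IH|now apply Sg with t].
    + intros x y. simpl. fold (p1 x) (p2 x).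
      revert y. induction (p2 x) as [|m IH]; intros y; simpl; [apply Ef|].
      intros (s & Hs & Hy). destruct (IH _ Hs) as [t1 H1], (Eg _ _ Hy) as [t2 H2].
      exists (t1 + t2). intros t Ht. rewrite H1, H2 by lia. reflexivity.
  - destruct IHf as (sf & Cf & Sf & Ef).
    exists (fun t x => Nat.pred (mu_scan (fun m => sf t ⟪x, m⟫) t)).
    split; [|split].
    + unfold mu_scan. computability.
    + intros t x y. generalize (mu_scan_spec (fun m => sf t ⟪x, m⟫) t).
      destruct (mu_scan _ t) as [|[|z]]; try discriminate.
      intros [Hz Hm] [= <-]. split; [eauto|].
      intros m Hmz. destruct (Hm m Hmz) as [k Hk]. eauto.
    + intros x y [Hy Hm].
      assert (B : forall n, n <= y -> exists t0, forall t, t0 <= t ->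
                forall m, m < n -> exists k, sf t ⟪x, m⟫ = S (S k)).
      { induction n as [|n IH]; intros Hn; [exists 0; lia|].
        destruct (IH ltac:(lia)) as [t1 H1], (Hm n ltac:(lia)) as [k Hk].
        destruct (Ef _ _ Hk) as [t2 H2].
        exists (t1 + t2). intros t Ht m Hmn.
        destruct (Nat.eq_dec m n) as [->|].
        - exists k. apply H2. lia.
        - apply H1; lia. }
      destruct (B y (le_n y)) as [t1 H1], (Ef _ _ Hy) as [t2 H2].
      exists (S y + t1 + t2). intros t Ht.
      rewrite mu_scan_found with (y := y); [reflexivity|apply H2; lia| |lia].
      apply H1. lia.
Qed.

(** Every c.e. relation is the union of an increasing sequence of uniformly
    decidable relations. *)
Lemma ce_rel_approximation R :
  ce_rel R ->
  exists Rt : nat -> nat -> nat -> bool,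
    computable3 (fun t x y => Nat.b2n (Rt t x y)) /\
    (forall t t' x y, t <= t' -> Rt t x y = true -> Rt t' x y = true) /\
    (forall x y, R x y <-> exists t, Rt t x y = true).
Proof.
  intros [u Hu].
  destruct (classic (exists c, encode c = u)) as [[c Hc]|Hno].
  - destruct (exists_stepped c) as (st & Cst & Sst & Est).
    exists (fun t x y => bex (fun s => negb (st s ⟪x, y⟫ =? 0)) t).
    split; [|split].
    + computability.
    + intros t t' x y Ht. rewrite !bex_true. intros (s & Hs & E).
      exists s. split; [lia|exact E].
    + intros x y. rewrite Hu. split.
      * intros (c' & Hc' & v & Hv).
        assert (c' = c) as -> by (apply encode_injective; congruence).
        destruct (Est _ _ Hv) as [t0 H0]. exists (S t0).
        apply bex_true. exists t0. split; [lia|]. now rewrite H0.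
      * intros [t Ht]. apply bex_true in Ht. destruct Ht as (s & _ & E).
        exists c. split; [exact Hc|].
        destruct (st s ⟪x, y⟫) as [|v] eqn:Es; [discriminate|eauto].
  - exists (fun _ _ _ => false). split; [|split].
    + computability.
    + discriminate.
    + intros x y. rewrite Hu. split.
      * intros (c & Hc & _). exfalso. eauto.
      * intros [t Ht]. discriminate.
Qed.

(** * Elements under delayed control *)

(** Unbounded search over a total function halts when there is a zero. *)
Lemma mu_halts c F z :
  (forall x, eval c x (F x)) ->
  (exists v, eval (Mu c) z v) <-> (exists w, F ⟪z, w⟫ = 0).
Proof.
  intros Hc. split.
  - intros (v & Hv & _). exists v. exact (eval_functional _ _ _ _ (Hc _) Hv).
  - intros [w Hw]. induction w as [w IH] using lt_wf_ind.
    destruct (classic (exists m, m < w /\ F ⟪z, m⟫ = 0)) as [(m & Hm & E)|Hno].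
    + exact (IH m Hm E).
    + exists w. split; [rewrite <- Hw; apply Hc|].
      intros m Hm. exists (Nat.pred (F ⟪z, m⟫)).
      destruct (F ⟪z, m⟫) as [|k] eqn:E; [exfalso; eauto|].
      simpl. rewrite <- E. apply Hc.
Qed.

(** An index of the constant function with value [x]. *)
Definition const_index (x : nat) : nat :=
  natrec ⟪0, 0⟫ (fun _ r => ⟪5, ⟪⟪1, 0⟫, r⟫⟫) x.

(** An index of the function [y |-> e⟪x, y⟫]; for [x] that contains [e] this
    gives programs access to their own index. *)
Definition curry_index (e x : nat) : nat :=
  ⟪5, ⟪e, ⟪4, ⟪const_index x, encode (Pair Fst Snd)⟫⟫⟫⟫.

Lemma computable2_curry_index : computable2 curry_index.
Proof. unfold curry_index, const_index. computability. Qed.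

Lemma const_index_spec x :
  exists c, encode c = const_index x /\ forall z v, eval c z v <-> v = x.
Proof.
  induction x as [|x (c & Ec & Hc)].
  - now exists Zero.
  - exists (Comp Succ c). split.
    + unfold const_index in *. simpl. now rewrite Ec.
    + intros z v. split.
      * intros (u & Hu & Hv). apply Hc in Hu. now subst u.
      * intros ->. exists x. split; [now apply Hc|reflexivity].
Qed.

Lemma W_curry_index c x y :
  W (curry_index (encode c) x) y <-> exists v, eval c ⟪x, y⟫ v.
Proof.
  destruct (const_index_spec x) as (d & Ed & Hd).
  assert (E : encode (Comp c (Pair d (Pair Fst Snd)))
              = curry_index (encode c) x).
  { unfold curry_index. rewrite <- Ed. reflexivity. }
  assert (Hid : forall z, eval (Pair Fst Snd) z z).
  { intros z. exists (p1 z), (p2 z). repeat split. symmetry. apply pair_p. }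
  split.
  - intros (c' & Ec' & v & Hv). rewrite <- E in Ec'.
    apply encode_injective in Ec'. subst c'.
    destruct Hv as (u & (u1 & u2 & H1 & H2 & ->) & Hv).
    apply Hd in H1. subst u1.
    rewrite (eval_functional _ _ _ _ H2 (Hid y)) in Hv. eauto.
  - intros [v Hv]. exists (Comp c (Pair d (Pair Fst Snd))).
    split; [exact E|]. exists v, ⟪x, y⟫. split; [|exact Hv].
    exists x, y. split; [now apply Hd|]. split; [apply Hid|reflexivity].
Qed.

(** Projections of decidable relations. *)
Definition semidecidable (A : nat -> Prop) : Prop :=
  exists At : nat -> nat -> bool,
    computable2 (fun t x => Nat.b2n (At t x)) /\
    forall x, A x <-> exists t, At t x = true.

(** [t] is the least number satisfying [P]. *)
Definition first_hit (P : nat -> bool) (t : nat) : bool :=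
  P t && ball (fun s => negb (P s)) t.

Lemma first_hit_true P t :
  first_hit P t = true <->
  P t = true /\ forall s, s < t -> P s = false.
Proof.
  unfold first_hit. rewrite andb_true_iff, ball_true.
  split; intros [H1 H2]; split; auto; intros s Hs;
    specialize (H2 s Hs); now apply negb_true_iff.
Qed.

Lemma first_hit_exists P t :
  P t = true -> exists t0, t0 <= t /\ first_hit P t0 = true.
Proof.
  induction t as [t IH] using lt_wf_ind. intros Ht.
  destruct (classic (exists s, s < t /\ P s = true)) as [(s & Hs & E)|Hno].
  - destruct (IH s Hs E) as (t0 & H0 & H1). exists t0. split; [lia|exact H1].
  - exists t. split; [lia|]. apply first_hit_true. split; [exact Ht|].
    intros s Hs. destruct (P s) eqn:E; [exfalso; eauto|reflexivity].
Qed.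

Lemma first_hit_unique P t t' :
  first_hit P t = true -> first_hit P t' = true -> t = t'.
Proof.
  intros H H'. apply first_hit_true in H, H'.
  destruct H as [H1 H2], H' as [H1' H2'].
  destruct (lt_eq_lt_dec t t') as [[L|L]|L]; auto.
  - rewrite H2' in H1; [discriminate|exact L].
  - rewrite H2 in H1'; [discriminate|exact L].
Qed.

(** For a suitable [e], the function [g] is total computable, [gs e t k] is the
    approximation of [g k] with budget [t] (again [0] for unknown and [S y] for
    [y]), and [g k] lies in [A] or in [B] as prescribed by [val] at the first
    stage at which [trig] holds.  The decisions receive [e] as an argument, so
    that they may depend on [g] through [gs e]; [gs] does not depend on them. *)
Lemma delayed_controls A B :
  semidecidable A -> semidecidable B -> effectively_inseparable A B ->
  exists gs : nat -> nat -> nat -> nat,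
    computable3 gs /\
    forall trig val : nat -> nat -> nat -> bool,
      computable3 (fun e t k => Nat.b2n (trig e t k)) ->
      computable3 (fun e t k => Nat.b2n (val e t k)) ->
      exists (e : nat) (g : nat -> nat),
        computable g /\
        (forall t k y, gs e t k = S y -> y = g k) /\
        (forall k, exists t0, forall t, t0 <= t -> gs e t k = S (g k)) /\
        (forall t k, first_hit (fun s => trig e s k) t = true ->
           if val e t k then B (g k) else A (g k)).
Proof.
  intros (At & CA & HA) (Bt & CB & HB) (Hdisj & phi & (cphi & Hphi) & Hprod).
  destruct (exists_stepped cphi) as (st & Cst & Sst & Est).
  (* The two c.e. sets attached to the control [k]. *)
  pose (ix := fun e k i => curry_index e ⟪e, ⟪k, i⟫⟫).
  pose proof computable2_curry_index as Ccurry.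
  assert (Cix : computable3 ix) by (unfold ix; computability).
  pose (gs := fun e t k => st t ⟪ix e k 0, ix e k 1⟫).
  assert (Cgs : computable3 gs) by (unfold gs; computability).
  exists gs. split; [exact Cgs|].
  intros trig val Ctrig Cval.
  (* [w] witnesses that [y] is [g k] and that the decision for [k] is [v]. *)
  pose (forced := fun e k w y (v : bool) =>
    first_hit (fun s => trig e s k) (p1 w) &&
    ((if v then val e (p1 w) k else negb (val e (p1 w) k)) &&
     (gs e (p2 w) k =? S y))).
  (* The input of [test] is [u = ⟪⟪⟪e, ⟪k, i⟫⟫, y⟫, w⟫]: does [w] witness that
     [y] belongs to the set with index [ix e k i]? *)
  pose (test := fun u =>
    let e := p1 (p1 (p1 u)) in
    let k := p1 (p2 (p1 (p1 u))) in
    let y := p2 (p1 u) in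
    let w := p2 u in
    if p2 (p2 (p1 (p1 u))) =? 0
    then At w y || forced e k w y true
    else Bt w y || forced e k w y false).
  assert (Ctest : computable (fun u => Nat.b2n (negb (test u)))).
  { unfold test, forced, first_hit. cbv zeta beta iota. computability. }
  destruct Ctest as [c Hc].
  (* The program searching for [w] is run on its own index. *)
  pose (e := encode (Mu c)).
  assert (W0 : forall k y, W (ix e k 0) y <->
            A y \/ exists w, forced e k w y true = true).
  { intros k y. unfold ix, e. rewrite W_curry_index, (mu_halts _ _ _ Hc).
    unfold test. cbv zeta. rewrite HA. split.
    - intros [w Hw]. unpair in Hw. fold e in Hw.
      destruct (At w y) eqn:E1; [left; eauto|].
      destruct (forced e k w y true) eqn:E2; [right; eauto|discriminate].
    - intros [[w Hw]|[w Hw]]; exists w;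
        unpair; fold e in Hw |- *;
        rewrite Hw; simpl; rewrite ?orb_true_r; reflexivity. }
  assert (W1 : forall k y, W (ix e k 1) y <->
            B y \/ exists w, forced e k w y false = true).
  { intros k y. unfold ix, e. rewrite W_curry_index, (mu_halts _ _ _ Hc).
    unfold test. cbv zeta. rewrite HB. split.
    - intros [w Hw]. unpair in Hw. fold e in Hw.
      destruct (Bt w y) eqn:E1; [left; eauto|].
      destruct (forced e k w y false) eqn:E2; [right; eauto|discriminate].
    - intros [[w Hw]|[w Hw]]; exists w;
        unpair; fold e in Hw |- *;
        rewrite Hw; simpl; rewrite ?orb_true_r; reflexivity. }
  assert (Hforced : forall k w y v, forced e k w y v = true ->
    first_hit (fun s => trig e s k) (p1 w) = true /\
    val e (p1 w) k = v /\ gs e (p2 w) k = S y).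
  { intros k w y v H. unfold forced in H.
    rewrite !andb_true_iff, Nat.eqb_eq in H. destruct H as (H1 & H2 & H3).
    repeat split; auto. destruct v; [exact H2|now apply negb_true_iff]. }
  (* If the productive function were undefined here, nothing would be added
     to [A] and [B], and it would have to be defined. *)
  assert (Htot : forall k, exists t, gs e t k <> 0).
  { intros k. apply NNPP. intros Hno.
    assert (N : forall w y v, forced e k w y v = true -> False).
    { intros w y v H. apply Hforced in H. destruct H as (_ & _ & H).
      apply Hno. exists (p2 w). now rewrite H. }
    destruct (Hprod (ix e k 0) (ix e k 1)) as (y & Hy & _).
    - intros x Hx. apply W0. now left.
    - intros x Hx. apply W1. now left.
    - intros x [H0 H1]. apply W0 in H0. apply W1 in H1.
      destruct H0 as [H0|[w H0]]; [|exact (N _ _ _ H0)].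
      destruct H1 as [H1|[w H1]]; [|exact (N _ _ _ H1)].
      exact (Hdisj x (conj H0 H1)).
    - apply Hphi in Hy. destruct (Est _ _ Hy) as [t Ht].
      apply Hno. exists t. unfold gs. now rewrite Ht. }
  assert (Hg : forall k, {t | gs e t k <> 0}).
  { intros k. apply constructive_indefinite_ground_description_nat.
    - intros t. destruct (gs e t k); [now right|now left].
    - apply Htot. }
  pose (g := fun k => Nat.pred (gs e (proj1_sig (Hg k)) k)).
  assert (Eg : forall k, eval cphi ⟪ix e k 0, ix e k 1⟫ (g k)).
  { intros k. unfold g. destruct (Hg k) as [t Ht]. simpl.
    apply Sst with t. fold (gs e t k). destruct (gs e t k); [easy|reflexivity]. }
  assert (Sg : forall t k y, gs e t k = S y -> y = g k).
  { intros t k y Hy. apply Sst in Hy. exact (eval_functional _ _ _ _ Hy (Eg k)). }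
  exists e, g. split; [|split; [exact Sg|split]].
  - assert (C : computable (fun k => ⟪ix e k 0, ix e k 1⟫)) by computability.
    destruct C as [d Hd]. exists (Comp cphi d). intros k.
    exists ⟪ix e k 0, ix e k 1⟫. auto.
  - intros k. exact (Est _ _ (Eg k)).
  - intros t k Ht.
    destruct (Est _ _ (Eg k)) as [s Hs].
    assert (F : forced e k ⟪t, s⟫ (g k) (val e t k) = true).
    { unfold forced. rewrite p1_pair, p2_pair, Ht. unfold gs.
      rewrite Hs, Nat.eqb_refl by lia. now destruct (val e t k). }
    assert (U : forall w y v, forced e k w y v = true ->
                  y = g k /\ v = val e t k).
    { intros w y v H. apply Hforced in H. destruct H as (H1 & H2 & H3).
      rewrite (first_hit_unique _ _ _ H1 Ht) in H2. eauto. }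
    (* Now [g k] has been put into one of the two sets to which the productive
       function is applied.  If it were outside the class prescribed by [val],
       these sets would still be disjoint, and [g k] would avoid both. *)
    destruct (val e t k); apply NNPP; intros HN.
    + destruct (Hprod (ix e k 0) (ix e k 1)) as (y & Hy & Hout).
      * intros x Hx. apply W0. now left.
      * intros x Hx. apply W1. now left.
      * intros x [H0 H1]. apply W0 in H0. apply W1 in H1.
        destruct H1 as [H1|[w H1]]; [|now apply U in H1].
        destruct H0 as [H0|[w H0]]; [exact (Hdisj x (conj H0 H1))|].
        apply U in H0. destruct H0 as [-> _]. exact (HN H1).
      * apply Hphi in Hy. rewrite (eval_functional _ _ _ _ Hy (Eg k)) in Hout.
        apply Hout. left. apply W0. right. eauto.
    + destruct (Hprod (ix e k 0) (ix e k 1)) as (y & Hy & Hout).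
      * intros x Hx. apply W0. now left.
      * intros x Hx. apply W1. now left.
      * intros x [H0 H1]. apply W0 in H0. apply W1 in H1.
        destruct H0 as [H0|[w H0]]; [|now apply U in H0].
        destruct H1 as [H1|[w H1]]; [exact (Hdisj x (conj H0 H1))|].
        apply U in H1. destruct H1 as [-> _]. exact (HN H0).
      * apply Hphi in Hy. rewrite (eval_functional _ _ _ _ Hy (Eg k)) in Hout.
        apply Hout. right. apply W1. right. eauto.
Qed.

(** * The elements of the embedding *)

(** Index of a control in slot [r] of the [n]-th element.  For [m < n], the
    control with [i = 0] is [c_m] and the one with [i = 1] is [d_m]; the pair
    [m = n], [i = 0] indexes the control that stands alone in [low]. *)
Definition ctl (n r m i : nat) : nat := ⟪⟪n, r⟫, ⟪m, i⟫⟫.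

(** The terms are built over arbitrary operations [J] and [M], constants [o] and
    [i] and controls [G], since they are needed both for the lattice itself and
    for its partial approximations. *)
Section Terms.
Variables (J M : nat -> nat -> nat) (o i : nat) (G : nat -> nat).

(** Slot [r] over the preceding elements [F m]: the join of the [F m] whose
    [c_m] is set to the top, and the meet of those whose [d_m] is set to the
    bottom.  The control that stands alone in [low] is needed to raise the slot
    to the top when there is no such [F m]. *)
Definition low (F : nat -> nat) (n r : nat) : nat :=
  natrec (G (ctl n r n 0)) (fun m s => J s (M (F m) (G (ctl n r m 0)))) n.

Definition up (F : nat -> nat) (n r : nat) : nat :=
  natrec i (fun m s => M s (J (F m) (G (ctl n r m 1)))) n.

(** The term [Z k] of the [n]-th element; slots are numbered from the inside,
    so that slot [r] surrounds [Z r]. *)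
Definition slots (F : nat -> nat) (n k : nat) : nat :=
  natrec o (fun r z => J (low F n r) (M (up F n r) z)) k.

(** Course-of-values recursion: [table n] is ⟪x_(n-1), ⟪x_(n-2), ...⟫⟫ for the
    first [n] elements, and [entry n h m] is the [m]-th element of a table [h] of
    length [n]. *)
Definition entry (n h m : nat) : nat := p1 (natrec h (fun _ => p2) (n - S m)).

Definition table (n : nat) : nat :=
  natrec 0 (fun n h => ⟪slots (entry n h) n (S (S (n + n))), h⟫) n.

Definition elt (n : nat) : nat := p1 (table (S n)).

Lemma entry_table n m : m < n -> entry n (table n) m = elt m.
Proof.
  intros H. unfold entry, elt.
  replace n with (n - S m + S m) at 1 by lia.
  generalize (n - S m). clear H n. intros d. f_equal.
  assert (E : forall d h,
    p2 (natrec h (fun _ => p2) d) = natrec (p2 h) (fun _ => p2) d).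
  { intros d' h. induction d' as [|d' IH]; simpl; congruence. }
  induction d as [|d IH]; [reflexivity|].
  rewrite <- IH at 1. simpl. rewrite E. f_equal.
  unfold table at 1. simpl. now unpair.
Qed.

Lemma natrec_ext b s s' n :
  (forall m x, m < n -> s m x = s' m x) -> natrec b s n = natrec b s' n.
Proof.
  intros H. induction n as [|n IH]; [reflexivity|].
  simpl. rewrite IH, H; auto.
Qed.

Lemma slots_ext F F' n k :
  (forall m, m < n -> F m = F' m) -> slots F n k = slots F' n k.
Proof.
  intros H. apply natrec_ext. intros r z _. unfold low, up.
  f_equal; [|f_equal]; apply natrec_ext; intros m x Hm; now rewrite H.
Qed.

Lemma elt_eq n : elt n = slots elt n (S (S (n + n))).
Proof.
  unfold elt at 1. unfold table. simpl. fold (table n). unpair.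
  change (slots (entry n (table n)) n (S (S (n + n)))
          = slots elt n (S (S (n + n)))).
  apply slots_ext. intros m. apply entry_table.
Qed.

End Terms.

Lemma computable2_elt J M o i (G : nat -> nat -> nat) :
  computable2 J -> computable2 M -> computable2 G ->
  computable2 (fun x n => elt J M o i (G x) n).
Proof.
  intros HJ HM HG.
  unfold elt, table, slots, low, up, entry, ctl. computability.
Qed.

(** * Approximation of the elements *)

(** Strict extension of an operation to partial values, coded by [0] and [S y]. *)
Definition lift (op : nat -> nat -> nat) (x y : nat) : nat :=
  match x with
  | 0 => 0
  | S x' => match y with 0 => 0 | S y' => S (op x' y') end
  end.

Lemma computable2_lift op : computable2 op -> computable2 (lift op).
Proof. intros H. unfold lift. computability. Qed.

(** The partial values [x t] are correct, and eventually defined. *)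
Definition approximates (x : nat -> nat) (y : nat) : Prop :=
  (forall t z, x t = S z -> z = y) /\
  exists t0, forall t, t0 <= t -> x t = S y.

Lemma approximates_const y : approximates (fun _ => S y) y.
Proof. split; [intros t z [= ->]; reflexivity|now exists 0]. Qed.

Lemma approximates_lift op x y x' y' :
  approximates x y -> approximates x' y' ->
  approximates (fun t => lift op (x t) (x' t)) (op y y').
Proof.
  intros [S1 [t1 E1]] [S2 [t2 E2]]. split.
  - intros t z. unfold lift. specialize (S1 t). specialize (S2 t).
    destruct (x t); [discriminate|]. destruct (x' t); [discriminate|].
    intros [= <-]. now rewrite (S1 _ eq_refl), (S2 _ eq_refl).
  - exists (t1 + t2). intros t Ht. rewrite E1, E2 by lia. reflexivity.
Qed.

Lemma approximates_natrec b b' s s' n :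
  approximates b b' ->
  (forall m x x', m < n -> approximates x x' ->
     approximates (fun t => s t m (x t)) (s' m x')) ->
  approximates (fun t => natrec (b t) (s t) n) (natrec b' s' n).
Proof.
  intros Hb Hs. induction n as [|n IH]; [exact Hb|].
  apply (Hs n (fun t => natrec (b t) (s t) n)); auto.
Qed.

Lemma approximates_ext x x' y :
  (forall t, x t = x' t) -> approximates x y -> approximates x' y.
Proof.
  intros E [S1 [t1 E1]]. split.
  - intros t z. rewrite <- E. apply S1.
  - exists t1. intros t. rewrite <- E. apply E1.
Qed.

Lemma approximates_elt J M o i (Gt : nat -> nat -> nat) G n :
  (forall k, approximates (fun t => Gt t k) (G k)) ->
  approximates (fun t => elt (lift J) (lift M) (S o) (S i) (Gt t) n)
    (elt J M o i G n).
Proof.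
  intros HG. induction n as [n IH] using lt_wf_ind.
  rewrite elt_eq.
  apply approximates_ext with (fun t =>
    slots (lift J) (lift M) (S o) (S i) (Gt t)
      (elt (lift J) (lift M) (S o) (S i) (Gt t)) n (S (S (n + n)))).
  { intros t. symmetry. apply elt_eq. }
  apply approximates_natrec; [apply approximates_const|].
  intros r z z' _ Hz.
  apply approximates_lift; [|apply approximates_lift; [|exact Hz]].
  - apply approximates_natrec; [apply HG|].
    intros m x x' Hm Hx. apply approximates_lift; [exact Hx|].
    apply approximates_lift; [now apply IH|apply HG].
  - apply approximates_natrec; [apply approximates_const|].
    intros m x x' Hm Hx. apply approximates_lift; [exact Hx|].
    apply approximates_lift; [now apply IH|apply HG].
Qed.

(** * Decisions for the controls *)

(** [Rt t] is the part of [R] enumerated by stage [t]; [sep t] holds when [t]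
    gives evidence that the construction should separate, and [chi t] is the set
    to be used in this case. *)
Section Decisions.
Variables (Rt : nat -> nat -> nat -> bool) (sep : nat -> bool)
  (chi : nat -> nat -> bool).

(** The number of relations between [n] and the [m < k], in both directions,
    that have not been enumerated by stage [t]. *)
Definition missing (t n k : nat) : nat :=
  natrec 0 (fun m c =>
    c + (Nat.b2n (negb (Rt t m n)) + Nat.b2n (negb (Rt t n m)))) k.

(** Slot [r] of the [n]-th element is decided once fewer than [r] relations are
    missing, or at a separation.  In particular slot [2n+1] is decided at once,
    and slot [0] only by a separation. *)
Definition trig (t k : nat) : bool :=
  (missing t (p1 (p1 k)) (p1 (p1 k)) <? p2 (p1 k)) || sep t.

(** A slot decided because of [Rt] copies the relations known at that stage;
    one decided by a separation copies [chi]. *)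
Definition val (t k : nat) : bool :=
  if missing t (p1 (p1 k)) (p1 (p1 k)) <? p2 (p1 k)
  then if p2 (p2 k) =? 0
       then (p1 (p2 k) <? p1 (p1 k)) && Rt t (p1 (p2 k)) (p1 (p1 k))
       else negb (Rt t (p1 (p1 k)) (p1 (p2 k)))
  else chi t (p1 (p1 k)).

Lemma trig_ctl t n r m i : trig t (ctl n r m i) = (missing t n n <? r) || sep t.
Proof. unfold trig, ctl. now unpair. Qed.

Lemma val_ctl t n r m i :
  val t (ctl n r m i) =
  if missing t n n <? r
  then if i =? 0 then (m <? n) && Rt t m n else negb (Rt t n m)
  else chi t n.
Proof. unfold val, ctl. now unpair. Qed.

Lemma missing_succ t n k :
  missing t n (S k) =
  missing t n k + (Nat.b2n (negb (Rt t k n)) + Nat.b2n (negb (Rt t n k))).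
Proof. reflexivity. Qed.

Lemma missing_le t n k : missing t n k <= k + k.
Proof.
  induction k as [|k IH]; [unfold missing; simpl; lia|]. rewrite missing_succ.
  destruct (Rt t k n), (Rt t n k); simpl; lia.
Qed.

Hypothesis Rt_mono :
  forall t t' x y, t <= t' -> Rt t x y = true -> Rt t' x y = true.

Lemma missing_mono t t' n k : t <= t' -> missing t' n k <= missing t n k.
Proof.
  intros Ht. induction k as [|k IH]; [unfold missing; simpl; lia|].
  rewrite !missing_succ.
  generalize (Rt_mono t t' k n Ht), (Rt_mono t t' n k Ht).
  destruct (Rt t k n), (Rt t n k), (Rt t' k n), (Rt t' n k);
    intros H1 H2; try discriminate (H1 eq_refl); try discriminate (H2 eq_refl);
    simpl; lia.
Qed.

(** If no relation is gained between two stages, then the relations are the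
    same. *)
Lemma missing_stable t t' n k :
  t <= t' -> missing t n k <= missing t' n k ->
  forall m, m < k -> Rt t' m n = Rt t m n /\ Rt t' n m = Rt t n m.
Proof.
  intros Ht. induction k as [|k IH]; [lia|].
  rewrite !missing_succ. intros Hle m Hm.
  assert (H0 := missing_mono t t' n k Ht).
  revert Hle IH. generalize (Rt_mono t t' k n Ht), (Rt_mono t t' n k Ht).
  destruct (Rt t k n) eqn:E1, (Rt t n k) eqn:E2,
    (Rt t' k n) eqn:E3, (Rt t' n k) eqn:E4;
    intros H1 H2; try discriminate (H1 eq_refl); try discriminate (H2 eq_refl);
    simpl; intros Hle IH; try lia;
    (destruct (Nat.eq_dec m k) as [->|]; [split; congruence|apply IH; lia]).
Qed.

(** The first stage at which all relations between [n] and smaller numbers have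
    been enumerated. *)
Lemma missing_min n : exists T,
  (forall t, missing T n n <= missing t n n) /\
  (forall t, t < T -> missing T n n < missing t n n).
Proof.
  assert (H : exists c, (exists t, missing t n n <= c) /\
            forall t, c <= missing t n n).
  { assert (H : forall d, (exists c, (exists t, missing t n n <= c) /\
            forall t, c <= missing t n n) \/ forall t, d <= missing t n n).
    { induction d as [|d [IH|IH]]; [right; lia|now left|].
      destruct (classic (exists t, missing t n n <= d)) as [H|H].
      - left. exists d. auto.
      - right. intros t. destruct (le_lt_dec (S d) (missing t n n)); auto.
        exfalso. apply H. exists t. lia. }
    destruct (H (S (n + n))) as [H'|H']; [exact H'|].
    exfalso. specialize (H' 0). generalize (missing_le 0 n n). lia. }
  destruct H as (c & (t & Ht) & Hc).
  destruct (first_hit_exists (fun t => missing t n n <=? c) t) as (T & _ & HT).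
  { now apply Nat.leb_le. }
  apply first_hit_true in HT. destruct HT as [H1 H2].
  apply Nat.leb_le in H1. exists T. split.
  - intros s. specialize (Hc s). lia.
  - intros s Hs. specialize (H2 s Hs). apply Nat.leb_gt in H2. lia.
Qed.

(** * Correctness *)

Variables (meet join : nat -> nat -> nat) (leq : nat -> nat -> Prop).
Variables (a b : nat) (g : nat -> nat) (R : nat -> nat -> Prop).
Hypothesis HL : ce_prelattice meet join leq.
Hypothesis Hab : leq a b.
Hypothesis Hg : forall k, interval leq a b (g k).
Hypothesis HR : PreOrder R.
Hypothesis R_iff : forall x y, R x y <-> exists t, Rt t x y = true.
Hypothesis Hctl : forall t k, first_hit (fun s => trig s k) t = true ->
  if val t k then leq b (g k) else leq (g k) a.


Local Notation f := (elt join meet a b g).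
Local Notation L n r := (low join meet g f n r).
Local Notation U n r := (up join meet b g f n r).
Local Notation Z n r := (slots join meet a b g f n r).

Lemma leq_refl x : leq x x.
Proof. apply (cep_preorder _ (cel_preorder _ _ _ HL)). Qed.

Lemma leq_tr x y z : leq x y -> leq y z -> leq x z.
Proof. apply (cep_preorder _ (cel_preorder _ _ _ HL)). Qed.

Lemma join_ge_l x y z : leq z x -> leq z (join x y).
Proof. intros H. apply leq_tr with x; [exact H|apply (cel_join_l _ _ _ HL)]. Qed.

Lemma join_ge_r x y z : leq z y -> leq z (join x y).
Proof. intros H. apply leq_tr with y; [exact H|apply (cel_join_r _ _ _ HL)]. Qed.

Lemma meet_le_l x y z : leq x z -> leq (meet x y) z.
Proof. intros H. apply leq_tr with x; [apply (cel_meet_l _ _ _ HL)|exact H]. Qed.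

Lemma meet_le_r x y z : leq y z -> leq (meet x y) z.
Proof. intros H. apply leq_tr with y; [apply (cel_meet_r _ _ _ HL)|exact H]. Qed.

Lemma join_interval x y :
  interval leq a b x -> interval leq a b y -> interval leq a b (join x y).
Proof.
  intros [H1 H2] [H3 H4]. split; [now apply join_ge_l|].
  now apply (cel_join_lub _ _ _ HL).
Qed.

Lemma meet_interval x y :
  interval leq a b x -> interval leq a b y -> interval leq a b (meet x y).
Proof.
  intros [H1 H2] [H3 H4]. split; [now apply (cel_meet_glb _ _ _ HL)|].
  now apply meet_le_l.
Qed.

Lemma f_eq n : f n = Z n (S (S (n + n))).
Proof. apply elt_eq. Qed.

Lemma Z_succ n r : Z n (S r) = join (L n r) (meet (U n r) (Z n r)).
Proof. reflexivity. Qed.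

Lemma natrec_interval c s n :
  interval leq a b c ->
  (forall m x, m < n -> interval leq a b x -> interval leq a b (s m x)) ->
  interval leq a b (natrec c s n).
Proof. intros Hc Hs. induction n as [|n IH]; [exact Hc|].
  apply Hs; [lia|]. apply IH. intros m x Hm. apply Hs. lia.
Qed.

Lemma f_interval n : interval leq a b (f n).
Proof.
  induction n as [n IH] using lt_wf_ind. rewrite f_eq.
  apply natrec_interval; [split; [apply leq_refl|exact Hab]|].
  intros r z _ Hz.
  apply join_interval; [|apply meet_interval; [|exact Hz]].
  - apply natrec_interval; [apply Hg|]. intros m x Hm Hx.
    apply join_interval; [exact Hx|]. apply meet_interval; auto.
  - apply natrec_interval; [split; [exact Hab|apply leq_refl]|]. intros m x Hm Hx.
    apply meet_interval; [exact Hx|]. apply join_interval; auto.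
Qed.

Lemma L_lub n r x :
  leq (g (ctl n r n 0)) x ->
  (forall m, m < n -> leq (meet (f m) (g (ctl n r m 0))) x) ->
  leq (L n r) x.
Proof.
  intros H0. unfold low. generalize (g (ctl n r n 0)) H0. clear H0.
  intros c H0 H.
  enough (E : forall k, k <= n -> leq (natrec c
    (fun m s => join s (meet (f m) (g (ctl n r m 0)))) k) x) by now apply E.
  induction k as [|k IH]; intros Hk; [exact H0|].
  apply (cel_join_lub _ _ _ HL); [apply IH; lia|apply H; lia].
Qed.

Lemma L_ge_init n r : leq (g (ctl n r n 0)) (L n r).
Proof.
  unfold low. generalize (g (ctl n r n 0)). intros c.
  generalize n at 2. intros k. induction k as [|k IH]; [apply leq_refl|].
  now apply join_ge_l.
Qed.

Lemma L_ge n r m : m < n -> leq (meet (f m) (g (ctl n r m 0))) (L n r).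
Proof.
  intros Hm. unfold low. generalize (g (ctl n r n 0)). intros c.
  enough (E : forall k, m < k -> leq (meet (f m) (g (ctl n r m 0))) (natrec c
    (fun m s => join s (meet (f m) (g (ctl n r m 0)))) k)) by now apply E.
  induction k as [|k IH]; intros Hk; [lia|]. simpl.
  destruct (Nat.eq_dec m k) as [->|].
  - apply join_ge_r, leq_refl.
  - apply join_ge_l, IH. lia.
Qed.

Lemma U_glb n r x :
  leq x b -> (forall m, m < n -> leq x (join (f m) (g (ctl n r m 1)))) ->
  leq x (U n r).
Proof.
  intros H0 H. unfold up.
  enough (E : forall k, k <= n -> leq x (natrec b
    (fun m s => meet s (join (f m) (g (ctl n r m 1)))) k)) by now apply E.
  induction k as [|k IH]; intros Hk; [exact H0|].
  apply (cel_meet_glb _ _ _ HL); [apply IH; lia|apply H; lia].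
Qed.

Lemma U_le n r m : m < n -> leq (U n r) (join (f m) (g (ctl n r m 1))).
Proof.
  intros Hm. unfold up.
  enough (E : forall k, m < k -> leq (natrec b
    (fun m s => meet s (join (f m) (g (ctl n r m 1)))) k)
    (join (f m) (g (ctl n r m 1)))) by now apply E.
  induction k as [|k IH]; intros Hk; [lia|]. simpl.
  destruct (Nat.eq_dec m k) as [->|].
  - apply meet_le_r, leq_refl.
  - apply meet_le_l, IH. lia.
Qed.

(** Slot [r] of the [n]-th element has been decided in accordance with
    [Rt t]. *)
Definition follows (t n r : nat) : Prop :=
  leq (g (ctl n r n 0)) a /\
  (forall m, m < n -> if Rt t m n then leq b (g (ctl n r m 0))
                      else leq (g (ctl n r m 0)) a) /\
  (forall m, m < n -> if Rt t n m then leq (g (ctl n r m 1)) a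
                      else leq b (g (ctl n r m 1))).

(** Stage [t] decides slot [r] of the [n]-th element. *)
Definition first_trig (t n r : nat) : Prop :=
  (missing t n n <? r) || sep t = true /\
  forall s, s < t -> (missing s n n <? r) || sep s = false.

Lemma first_trig_hit t n r m i :
  first_trig t n r -> first_hit (fun s => trig s (ctl n r m i)) t = true.
Proof.
  intros [H1 H2]. apply first_hit_true. split; [now rewrite trig_ctl|].
  intros s Hs. rewrite trig_ctl. auto.
Qed.

Lemma first_trig_exists t n r :
  (missing t n n <? r) || sep t = true -> exists t0, t0 <= t /\ first_trig t0 n r.
Proof.
  intros H.
  destruct (first_hit_exists (fun t => (missing t n n <? r) || sep t) t H)
    as (t0 & H0 & H1).
  apply first_hit_true in H1. now exists t0.
Qed.

Lemma follows_first_trig t n r :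
  first_trig t n r -> missing t n n < r -> follows t n r.
Proof.
  intros Ht Hr. apply Nat.ltb_lt in Hr. split; [|split].
  - generalize (Hctl _ _ (first_trig_hit _ _ _ n 0 Ht)).
    rewrite val_ctl, Hr. simpl. now rewrite Nat.ltb_irrefl.
  - intros m Hm. generalize (Hctl _ _ (first_trig_hit _ _ _ m 0 Ht)).
    rewrite val_ctl, Hr. simpl. now rewrite (proj2 (Nat.ltb_lt m n) Hm).
  - intros m Hm. generalize (Hctl _ _ (first_trig_hit _ _ _ m 1 Ht)).
    rewrite val_ctl, Hr. simpl. now destruct (Rt t n m).
Qed.

(** In this section no separation ever occurs, so that all decisions are made by
    true relations. *)
Section Positive.
Hypothesis Hsep : forall t, sep t = false.

(** The innermost decided slot [missing T n n + 1] places [f n] correctly; the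
    slots around it preserve this, as they were decided by true relations. *)
Lemma f_monotone_below n :
  (forall m p, m < n -> p < n -> R m p -> leq (f m) (f p)) ->
  forall p, p < n -> (R p n -> leq (f p) (f n)) /\ (R n p -> leq (f n) (f p)).
Proof.
  intros IH p Hp.
  destruct (missing_min n) as (T & Hmin & Hfirst).
  assert (HT : follows T n (S (missing T n n))).
  { apply follows_first_trig; [|lia]. split.
    - rewrite (proj2 (Nat.ltb_lt _ _)) by lia. reflexivity.
    - intros s Hs. rewrite Hsep, orb_false_r. apply Nat.ltb_ge.
      now apply Hfirst. }
  (* All slots further out have been decided as well, possibly earlier. *)
  assert (HD : forall r, missing T n n < r -> exists t, follows t n r).
  { intros r Hr. destruct (first_trig_exists T n r) as (t & Ht & H).
    - now rewrite (proj2 (Nat.ltb_lt _ _) Hr).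
    - exists t. apply follows_first_trig; [exact H|].
      destruct H as [H _]. rewrite Hsep, orb_false_r in H. now apply Nat.ltb_lt. }
  assert (Hfinal : forall m, m < n ->
            (R m n -> Rt T m n = true) /\ (R n m -> Rt T n m = true)).
  { intros m Hm. split; intros H; apply R_iff in H; destruct H as [t Ht].
    - destruct (missing_stable T (T + t) n n ltac:(lia) (Hmin _) m Hm) as [<- _].
      apply Rt_mono with t; [lia|exact Ht].
    - destruct (missing_stable T (T + t) n n ltac:(lia) (Hmin _) m Hm) as [_ <-].
      apply Rt_mono with t; [lia|exact Ht]. }
  assert (Hlast : S (missing T n n) <= S (n + n)).
  { generalize (missing_le T n n). lia. }
  rewrite (f_eq n). generalize dependent (S (n + n)). intros k Hlast.
  split; intros Hpn.
  - induction Hlast as [|r Hr IHr].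
    + rewrite Z_succ. apply join_ge_l.
      apply leq_tr with (meet (f p) (g (ctl n (S (missing T n n)) p 0)));
        [|now apply L_ge].
      apply (cel_meet_glb _ _ _ HL); [apply leq_refl|].
      destruct HT as (_ & H & _). specialize (H p Hp).
      rewrite (proj1 (Hfinal p Hp) Hpn) in H.
      apply leq_tr with b; [apply f_interval|exact H].
    + rewrite Z_succ. apply join_ge_r, (cel_meet_glb _ _ _ HL); [|exact IHr].
      destruct (HD (S r) ltac:(lia)) as (t & _ & _ & H).
      apply U_glb; [apply f_interval|].
      intros m Hm. specialize (H m Hm). destruct (Rt t n m) eqn:E.
      * apply join_ge_l, IH; auto. transitivity n; [exact Hpn|].
        apply R_iff. eauto.
      * apply join_ge_r, leq_tr with b; [apply f_interval|exact H].
  - assert (HL' : forall t r, follows t n r -> leq (L n r) (f p)).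
    { intros t r (H0 & H & _). apply L_lub.
      - apply leq_tr with a; [exact H0|apply f_interval].
      - intros m Hm. specialize (H m Hm). destruct (Rt t m n) eqn:E.
        + apply meet_le_l, IH; auto. transitivity n; [|exact Hpn].
          apply R_iff. eauto.
        + apply meet_le_r, leq_tr with a; [exact H|apply f_interval]. }
    induction Hlast as [|r Hr IHr].
    + rewrite Z_succ. apply (cel_join_lub _ _ _ HL); [exact (HL' _ _ HT)|].
      apply meet_le_l. apply leq_tr with (1 := U_le n _ p Hp).
      destruct HT as (_ & _ & H). specialize (H p Hp).
      rewrite (proj2 (Hfinal p Hp) Hpn) in H.
      apply (cel_join_lub _ _ _ HL); [apply leq_refl|].
      apply leq_tr with a; [exact H|apply f_interval].
    + rewrite Z_succ. apply (cel_join_lub _ _ _ HL); [|now apply meet_le_r].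
      destruct (HD (S r) ltac:(lia)) as (t & H). exact (HL' _ _ H).
Qed.

Lemma f_monotone x y : R x y -> leq (f x) (f y).
Proof.
  enough (H : forall n m p, m < n -> p < n -> R m p -> leq (f m) (f p)).
  { apply (H (S (x + y))); lia. }
  induction n as [|n IH]; [lia|]. intros m p Hm Hp Hmp.
  destruct (Nat.eq_dec m n) as [->|], (Nat.eq_dec p n) as [->|].
  - apply leq_refl.
  - now apply (f_monotone_below n IH p ltac:(lia)).
  - now apply (f_monotone_below n IH m ltac:(lia)).
  - apply IH; auto; lia.
Qed.
End Positive.

(** At the first separation, every slot is either already decided by relations
    that respect the separating set, or set according to it; hence the
    elements up to [N] collapse to [b] inside the set and to [a] outside. *)
Lemma separation_decides T N :
  first_hit sep T = true ->
  (forall m m', m <= N -> m' <= N ->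
     chi T m = true -> Rt T m m' = true -> chi T m' = true) ->
  forall n, n <= N -> if chi T n then leq b (f n) else leq (f n) a.
Proof.
  intros HT Hclosed. apply first_hit_true in HT. destruct HT as [HT HTfirst].
  (* The outer slots follow relations enumerated by stage [T]. *)
  assert (Hpat : forall n r, missing T n n < r ->
            exists t, t <= T /\ follows t n r).
  { intros n r Hr. destruct (first_trig_exists T n r) as (t & Ht & H).
    - now rewrite HT, orb_true_r.
    - exists t. split; [exact Ht|]. apply follows_first_trig; [exact H|].
      destruct (Nat.ltb_spec (missing t n n) r) as [|Hge]; [assumption|].
      destruct H as [H _]. rewrite (proj2 (Nat.ltb_ge _ _) Hge) in H.
      destruct (Nat.eq_dec t T) as [->|]; [lia|].
      rewrite HTfirst in H by lia. discriminate. }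
  (* The inner slots are decided at stage [T], by the set. *)
  assert (Hset : forall n r, r <= missing T n n -> forall m i,
            if chi T n then leq b (g (ctl n r m i)) else leq (g (ctl n r m i)) a).
  { intros n r Hr m i.
    assert (Ht : first_trig T n r).
    { split; [now rewrite HT, orb_true_r|].
      intros s Hs. rewrite HTfirst, orb_false_r by exact Hs.
      apply Nat.ltb_ge. generalize (missing_mono s T n n ltac:(lia)). lia. }
    generalize (Hctl _ _ (first_trig_hit _ _ _ m i Ht)).
    now rewrite val_ctl, (proj2 (Nat.ltb_ge _ _) Hr). }
  induction n as [n IH] using lt_wf_ind. intros Hn.
  rewrite (f_eq n). destruct (chi T n) eqn:En.
  - assert (Hlast : missing T n n <= S (n + n)).
    { generalize (missing_le T n n). lia. }
    generalize dependent (S (n + n)). intros k Hlast.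
    induction Hlast as [|r Hr IHr].
    + rewrite Z_succ. apply join_ge_l, leq_tr with (2 := L_ge_init n _).
      generalize (Hset n _ (le_n _) n 0). now rewrite En.
    + rewrite Z_succ. apply join_ge_r, (cel_meet_glb _ _ _ HL); [|exact IHr].
      destruct (Hpat n (S r) ltac:(lia)) as (t & Ht & _ & _ & H).
      apply U_glb; [apply leq_refl|].
      intros m Hm. specialize (H m Hm). destruct (Rt t n m) eqn:E.
      * apply join_ge_l. generalize (IH m Hm ltac:(lia)).
        rewrite (Hclosed n m); auto; [lia|]. exact (Rt_mono _ _ _ _ Ht E).
      * now apply join_ge_r.
  - generalize (S (S (n + n))). intros k. induction k as [|r IHr]; [apply leq_refl|].
    rewrite Z_succ. apply (cel_join_lub _ _ _ HL); [|now apply meet_le_r].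
    destruct (le_lt_dec r (missing T n n)) as [Hr|Hr].
    + apply L_lub.
      * generalize (Hset n r Hr n 0). now rewrite En.
      * intros m Hm. apply meet_le_r. generalize (Hset n r Hr m 0). now rewrite En.
    + destruct (Hpat n r Hr) as (t & Ht & H0 & H & _).
      apply L_lub; [exact H0|].
      intros m Hm. specialize (H m Hm). destruct (Rt t m n) eqn:E.
      * apply meet_le_l. generalize (IH m Hm ltac:(lia)).
        destruct (chi T m) eqn:Em; [|auto].
        rewrite (Hclosed m n) in En; [discriminate|lia|lia|exact Em|].
        exact (Rt_mono _ _ _ _ Ht E).
      * now apply meet_le_r.
Qed.

End Decisions.

(** * The reduction *)

(** Membership of [m] in the set coded by [X], whose characteristic sequence is
    [p1 X], [p1 (p2 X)], [p1 (p2 (p2 X))] and so on. *)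
Definition mem (m X : nat) : bool := p1 (natrec X (fun _ => p2) m) =? 1.

(** Every set agrees with a coded one below [N]. *)
Lemma mem_exists (P : nat -> Prop) N :
  exists X, forall m, m < N -> mem m X = true <-> P m.
Proof.
  revert P. induction N as [|N IH]; intros P; [exists 0; lia|].
  destruct (IH (fun m => P (S m))) as [X HX].
  assert (E : forall m c, natrec ⟪c, X⟫ (fun _ => p2) (S m)
                          = natrec X (fun _ => p2) m).
  { intros m c. induction m as [|m IHm]; [apply p2_pair|].
    simpl in *. now rewrite IHm. }
  destruct (classic (P 0)) as [H0|H0];
    [exists ⟪1, X⟫|exists ⟪0, X⟫]; intros [|m] Hm;
    unfold mem; rewrite ?E.
  - simpl. rewrite p1_pair. easy.
  - apply HX. lia.
  - simpl. rewrite p1_pair. split; [discriminate|contradiction].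
  - apply HX. lia.
Qed.

Lemma semidecidable_eq_class leq x : ce_rel leq -> semidecidable (eq_class leq x).
Proof.
  intros H. destruct (ce_rel_approximation _ H) as (Lt & CL & Lmono & HL).
  exists (fun t y => Lt t y x && Lt t x y). split.
  - computability.
  - intros y. unfold eq_class, equ. rewrite !HL. split.
    + intros [[t1 H1] [t2 H2]]. exists (t1 + t2). apply andb_true_iff.
      split; [apply Lmono with t1|apply Lmono with t2]; auto; lia.
    + intros [t Ht]. apply andb_true_iff in Ht. destruct Ht. eauto.
Qed.

Theorem corollary43 (meet join : nat -> nat -> nat) (leq : nat -> nat -> Prop)
  (HL : ce_prelattice meet join leq) (a b : nat) (Hab : lt_of leq a b)
  (Hei : effectively_inseparable (eq_class leq a) (eq_class leq b)) :
  forall R : nat -> nat -> Prop, ce_preorder R ->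
    exists f : nat -> nat,
      computable f /\
      (forall x, interval leq a b (f x)) /\
      (forall x y, R x y <-> leq (f x) (f y)).
Proof.
  intros R [HRpre HRce _]. destruct Hab as [Hab Hba].
  pose proof (cel_preorder _ _ _ HL) as [Hpre Hce _].
  pose proof (cel_meet_computable _ _ _ HL) as Cmeet.
  pose proof (cel_join_computable _ _ _ HL) as Cjoin.
  destruct (ce_rel_approximation _ HRce) as (Rt & CR & Rmono & HR).
  destruct (ce_rel_approximation _ Hce) as (Lt & CL & Lmono & HLt).
  destruct (delayed_controls _ _ (semidecidable_eq_class leq a Hce)
    (semidecidable_eq_class leq b Hce) Hei) as (gs & Cgs & Hgs).
  (* The controls are moved into [[a,b]], which respects both classes. *)
  pose (clip := fun x => meet (join x a) b).
  pose (fs := fun e t n => elt (lift join) (lift meet) (S a) (S b)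
    (fun k => match gs e t k with 0 => 0 | S y => S (clip y) end) n).
  assert (Cfs : computable3 fs).
  { assert (C : computable2 (fun x n =>
      elt (lift join) (lift meet) (S a) (S b)
        (fun k => match gs (p1 x) (p2 x) k with
                  | 0 => 0
                  | S y => S (clip y)
                  end) n)).
    { apply (computable2_elt (lift join) (lift meet) (S a) (S b)
        (fun x k => match gs (p1 x) (p2 x) k with
                    | 0 => 0
                    | S y => S (clip y)
                    end));
        try (apply computable2_lift; assumption).
      unfold clip. computability. }
    assert (C' : computable3 (fun e t n =>
      elt (lift join) (lift meet) (S a) (S b)
        (fun k => match gs (p1 ⟪e, t⟫) (p2 ⟪e, t⟫) k with
                  | 0 => 0
                  | S y => S (clip y)
                  end) n)).
    { apply (computable_app2 _ _ _ C); computability. }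
    generalize C'. apply computable_ext. intros p. cbv beta.
    now rewrite p1_pair, p2_pair. }
  (* Stage [t = ⟪i, ⟪j, ⟪X, s⟫⟫⟫] separates if budget [s] suffices to see that
     [f i <= f j], and the set [X] contains [i], omits [j], and is closed upwards
     under [Rt t] among the numbers up to [i + j]. *)
  pose (sep := fun e t =>
    let i := p1 t in let j := p1 (p2 t) in
    let X := p1 (p2 (p2 t)) in let s := p2 (p2 (p2 t)) in
    negb (fs e s i =? 0) && (negb (fs e s j =? 0) &&
    (Lt s (Nat.pred (fs e s i)) (Nat.pred (fs e s j)) &&
    (mem i X && (negb (mem j X) &&
    ball (fun m => ball (fun m' =>
      negb (mem m X && Rt t m m') || mem m' X) (S (i + j))) (S (i + j))))))).
  pose (chi := fun t n => mem n (p1 (p2 (p2 t)))).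
  assert (Cmem : computable2 (fun m X => Nat.b2n (mem m X))).
  { unfold mem. computability. }
  assert (Cmiss : computable3 (missing Rt)).
  { unfold missing. computability. }
  assert (Csep : computable2 (fun e t => Nat.b2n (sep e t))).
  { unfold sep. cbv zeta. computability. }
  assert (Cchi : computable2 (fun t n => Nat.b2n (chi t n))).
  { unfold chi. computability. }
  destruct (Hgs (fun e => trig Rt (sep e)) (fun _ => val Rt chi))
    as (e & g & Cg & Sg & Eg & Hctl).
  { unfold trig. computability. }
  { unfold val. computability. }
  pose (gc := fun k => clip (g k)).
  pose (fe := elt join meet a b gc).
  assert (Hap : forall n, approximates (fun t => fs e t n) (fe n)).
  { intros n. unfold fs, fe. apply (approximates_elt join meet a b
      (fun t k => match gs e t k with 0 => 0 | S y => S (clip y) end)).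
    intros k. split.
    - intros t z. destruct (gs e t k) as [|y] eqn:E; [discriminate|].
      intros [= <-]. unfold gc. now rewrite (Sg _ _ _ E).
    - destruct (Eg k) as [t0 H0]. exists t0. intros t Ht. now rewrite H0. }
  assert (Hclip : forall x, interval leq a b (clip x)).
  { intros x. split.
    - apply (cel_meet_glb _ _ _ HL); [apply (cel_join_r _ _ _ HL)|exact Hab].
    - apply (cel_meet_r _ _ _ HL). }
  assert (Hcl_a : forall x, leq x a -> leq (clip x) a).
  { intros x Hx. transitivity (join x a); [apply (cel_meet_l _ _ _ HL)|].
    apply (cel_join_lub _ _ _ HL); [exact Hx|reflexivity]. }
  assert (Hcl_b : forall x, leq b x -> leq b (clip x)).
  { intros x Hx. apply (cel_meet_glb _ _ _ HL); [|reflexivity].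
    transitivity x; [exact Hx|apply (cel_join_l _ _ _ HL)]. }
  assert (Hgc : forall t k,
    first_hit (fun s => trig Rt (sep e) s k) t = true ->
    if val Rt chi t k then leq b (gc k) else leq (gc k) a).
  { intros t k Ht. specialize (Hctl t k Ht).
    destruct (val Rt chi t k); [apply Hcl_b|apply Hcl_a]; apply Hctl. }
  assert (Hgi : forall k, interval leq a b (gc k)) by (intros k; apply Hclip).
  assert (Hint : forall n, interval leq a b (fe n)).
  { intros n. exact (f_interval meet join leq a b gc HL Hab Hgi n). }
  (* A separation would make [b <= f i <= f j <= a]. *)
  assert (Hnosep : forall t, sep e t = false).
  { intros t. destruct (sep e t) eqn:Et; [exfalso|reflexivity].
    destruct (first_hit_exists _ _ Et) as (T & _ & HT).
    assert (HsT : sep e T = true) by now apply first_hit_true in HT.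
    unfold sep in HsT. cbv zeta in HsT.
    set (i := p1 T) in *. set (j := p1 (p2 T)) in *.
    set (X := p1 (p2 (p2 T))) in *. set (s := p2 (p2 (p2 T))) in *.
    rewrite !andb_true_iff, !negb_true_iff, !Nat.eqb_neq, ball_true in HsT.
    destruct HsT as (H1 & H2 & H3 & H4 & H5 & H6).
    assert (Hij : leq (fe i) (fe j)).
    { apply HLt. exists s.
      destruct (Hap i) as [Si _], (Hap j) as [Sj _].
      specialize (Si s). specialize (Sj s). revert Si Sj H1 H2 H3.
      destruct (fs e s i) as [|y]; [easy|]. destruct (fs e s j) as [|z]; [easy|].
      intros Si Sj _ _. now rewrite <- (Si y eq_refl), <- (Sj z eq_refl). }
    assert (D : forall n, n <= i + j ->
              if chi T n then leq b (fe n) else leq (fe n) a).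
    { apply (separation_decides Rt (sep e) chi Rmono meet join leq a b gc);
        auto.
      intros m m' Hm Hm' Hc Hr. specialize (H6 m ltac:(lia)).
      rewrite ball_true in H6. specialize (H6 m' ltac:(lia)).
      unfold chi in *. fold X in Hc |- *. now rewrite Hc, Hr in H6. }
    assert (Di := D i ltac:(lia)). assert (Dj := D j ltac:(lia)).
    unfold chi in Di, Dj. fold X in Di, Dj. rewrite H4 in Di. rewrite H5 in Dj.
    apply Hba. transitivity (fe i); [exact Di|].
    transitivity (fe j); assumption. }
  exists fe. split; [|split; [exact Hint|]].
  - assert (C : computable2 (fun _ n => elt join meet a b gc n)).
    { apply (computable2_elt join meet a b (fun _ k => gc k)); auto.
      unfold gc, clip. computability. }
    apply (computable_app2 _ (fun x => x) (fun x => x) C); computability.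
  - intros x y. split.
    + exact (f_monotone Rt (sep e) chi Rmono meet join leq a b gc R
        HL Hab Hgi HRpre HR Hgc Hnosep x y).
    + intros Hxy. apply NNPP. intros HRxy.
      (* The upper cone of [x] separates [x] from [y]. *)
      destruct (mem_exists (R x) (S (x + y))) as [X HX].
      destruct (Hap x) as [_ [t1 H1]], (Hap y) as [_ [t2 H2]].
      apply HLt in Hxy. destruct Hxy as [t3 H3].
      pose (s := t1 + t2 + t3).
      enough (E : sep e ⟪x, ⟪y, ⟪X, s⟫⟫⟫ = true).
      { rewrite Hnosep in E. discriminate. }
      unfold sep. cbv zeta. rewrite !p2_pair, !p1_pair.
      rewrite (H1 s), (H2 s) by (unfold s; lia). simpl Nat.pred.
      rewrite (Lmono t3 s) by (auto; unfold s; lia).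
      rewrite (proj2 (HX x ltac:(lia))) by reflexivity.
      destruct (mem y X) eqn:Ey.
      { exfalso. apply HRxy, HX; [lia|exact Ey]. }
      cbn [Nat.eqb negb andb]. apply ball_true. intros m Hm.
      apply ball_true. intros m' Hm'.
      destruct (mem m X) eqn:Em; [|reflexivity].
      destruct (Rt _ m m') eqn:Er; [|reflexivity].
      simpl. apply HX; [exact Hm'|].
      transitivity m; [apply HX; assumption|]. apply HR. eauto.
Qed.
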